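(* Assume the Continuum Hypothesis. Then there exists an $\omega^\omega$-ultrafilter $\mathcal U$ on $\omega$ such that every nonprincipal ultrafilter $\mathcal W$ with $\mathcal W\le_{RK}\mathcal U$ is also an $\omega^\omega$-ultrafilter.
   Context: All ultrafilters are on $\omega$. For $f:\omega\to\omega$ and an ultrafilter $\mathcal V$, $f(\mathcal V)=\{A\subseteq\omega: f^{-1}(A)\in\mathcal V\}$; $\mathcal W\le_{RK}\mathcal U$ means $\mathcal W=f(\mathcal U)$ for some $f:\omega\to\omega$. For an ordinal $\alpha\le\omega_1$, a nonprincipal ultrafilter $\mathcal U$ is an $\alpha$-ultrafilter if $\alpha$ is the smallest ordinal such that for every $h:\omega\to\omega_1$ there is $X\in\mathcal U$ such that $h''X=\{h(n):n\in X\}$ has order type at most $\alpha$. $\omega^\omega$ denotes ordinal exponentiation. *)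

(* Defs.v *)
From HB Require Import structures.
From mathcomp Require Import all_boot all_order all_classical.
From mathcomp Require Import wochoice.

Set Implicit Arguments.
Unset Strict Implicit.
Unset Printing Implicit Defensive.

Local Open Scope classical_set_scope.
Local Open Scope quotient_scope.
Local Open Scope card_scope.

(* Ordinals are represented by well-ordered types, compared by their order
   types; [well_order] is the one of mathcomp.classical.wochoice. *)

Record woset := WOSet {
  wo_car :> Type;
  wo_le : rel wo_car;
  wo_leP : well_order wo_le }.
Arguments wo_le {w}.

Definition wo_lt (W : woset) (x y : W) : bool := ~~ wo_le y x.

Section WosetTheory.
Variable W : woset.
Implicit Types x y z : W.

Lemma wo_min (A : set W) : A !=set0 ->
  exists2 z, A z & forall x, A x -> wo_le z x.
Proof.
case=> a Aa; have [|z [[zA zmin] _]] := @wo_leP W (mem A).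
  by exists a; apply/mem_set.
by exists z => [|x Ax]; [exact/set_mem|exact/zmin/mem_set].
Qed.

Lemma wo_le_total x y : wo_le x y || wo_le y x.
Proof.
have [|z /= [->|->] zmin] := @wo_min [set u | u = x \/ u = y].
- by exists x; left.
- by rewrite zmin //; right.
- by rewrite (zmin x) ?orbT //; left.
Qed.

Lemma wo_lexx x : wo_le x x.
Proof. by rewrite -[wo_le x x]orbb wo_le_total. Qed.

Lemma wo_le_anti x y : wo_le x y -> wo_le y x -> x = y.
Proof.
move=> xy yx.
have [|z [_ zu]] := @wo_leP W (mem [set u | u = x \/ u = y]).
  by exists x; apply/mem_set; left.
have zE u : wo_le u x -> wo_le u y -> u = x \/ u = y -> z = u.
  by move=> ux uy uA; apply: zu; split; [exact/mem_set|move=> v /set_mem [->|->]].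
by rewrite -(zE x) ?wo_lexx //; [apply: zE; rewrite ?wo_lexx //; right|left].
Qed.

Lemma wo_le_trans y x z : wo_le x y -> wo_le y z -> wo_le x z.
Proof.
move=> xy yz.
have [|u /= uA umin] := @wo_min [set u | [\/ u = x, u = y | u = z]].
  by exists x; apply: Or31.
have [ux uy uz] : [/\ wo_le u x, wo_le u y & wo_le u z].
  by split; apply: umin; [apply: Or31|apply: Or32|apply: Or33].
case: uA => uE; rewrite uE in ux uy uz => //.
  by rewrite (wo_le_anti xy ux).
by rewrite -(wo_le_anti yz uy).
Qed.

Lemma wo_ltW x y : wo_lt x y -> wo_le x y.
Proof. by rewrite /wo_lt => yx; have := wo_le_total x y; rewrite (negbTE yx) orbF. Qed.

Lemma wo_ltxx x : wo_lt x x = false.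
Proof. by rewrite /wo_lt wo_lexx. Qed.

Lemma wo_lt_trans y x z : wo_lt x y -> wo_lt y z -> wo_lt x z.
Proof.
move=> xy yz; apply/negP => zx; move/negP: yz; apply.
exact: wo_le_trans zx (wo_ltW xy).
Qed.

Lemma wo_ltgt x y : [\/ wo_lt x y, x = y | wo_lt y x].
Proof.
have [yx|] := boolP (wo_le y x); last exact: Or31.
have [xy|] := boolP (wo_le x y); last exact: Or33.
by apply: Or32; exact: wo_le_anti.
Qed.

Lemma wo_ind (P : W -> Prop) :
  (forall x, (forall y, wo_lt y x -> P y) -> P x) -> forall x, P x.
Proof.
move=> IH x; apply: contrapT => nPx.
have [|z /= nPz zmin] := @wo_min [set u | ~ P u]; first by exists x.
apply: nPz; apply: IH => y yz; apply: contrapT => /zmin zy.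
by rewrite /wo_lt zy in yz.
Qed.

End WosetTheory.

Lemma well_order_intro (T : Type) (R : rel T) :
  (forall x y, R x y -> R y x -> x = y) ->
  (forall A : set T, A !=set0 -> exists2 z, A z & forall x, A x -> R z x) ->
  well_order R.
Proof.
move=> Ra Rm; apply: antisymmetric_well_order => [x y /andP[]|A [a Aa]].
  exact: Ra.
have [|z Az zmin] := Rm [set x | x \in A]; first by exists a.
by exists z; split.
Qed.

(* Comparison of ordinals: V is isomorphic to an initial segment of W. *)
Definition ot_le (V W : woset) : Prop :=
  exists f : V -> W, {mono f : x y / wo_le x y} /\
    forall x y, wo_le y (f x) -> exists x', f x' = y.

Definition ot_eq (V W : woset) : Prop :=
  exists2 f : V -> W, bijective f & {mono f : x y / wo_le x y}.

Lemma wo_le_val_well_order (W : woset) (A : set W) :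
  well_order (fun x y : A => wo_le (val x) (val y)).
Proof.
apply: well_order_intro => [x y xy yx|B [b Bb]].
  by apply/val_inj/wo_le_anti.
have [|_ [z Bz <-] zmin] := @wo_min W [set val x | x in B].
  by exists (val b), b.
by exists z => // x Bx; apply: zmin; exists x.
Qed.

Definition sub_woset (W : woset) (A : set W) : woset :=
  WOSet (@wo_le_val_well_order W A).

Section Bisim.
Variables V W : woset.

Definition bisim (S : V -> W -> Prop) := forall x y, S x y ->
  (forall x', wo_lt x' x -> exists2 y', wo_lt y' y & S x' y') /\
  (forall y', wo_lt y' y -> exists2 x', wo_lt x' x & S x' y').

Definition same_rank x y := exists2 S, bisim S & S x y.

Lemma same_rank_bisim : bisim same_rank.
Proof.
move=> x y [S bS Sxy]; have [h1 h2] := bS _ _ Sxy.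
by split=> z /[dup] zlt; [move/h1 => [t tl St]|move/h2 => [t tl St]];
  exists t => //; exists S.
Qed.

End Bisim.

Lemma same_rankC (V W : woset) (x : V) (y : W) : same_rank x y -> same_rank y x.
Proof.
case=> S bS Sxy; exists (fun a b => S b a) => // a b /bS[h1 h2]; split.
- exact: h2.
- exact: h1.
Qed.

Lemma same_rank_trans (U V W : woset) (x : U) (y : V) (z : W) :
  same_rank x y -> same_rank y z -> same_rank x z.
Proof.
case=> S bS Sxy [T bT Tyz].
exists (fun a c => exists2 b, S a b & T b c); last by exists y.
move=> a c [b Sab Tbc]; have [s1 s2] := bS _ _ Sab; have [t1 t2] := bT _ _ Tbc.
split=> [a' /s1[b' /t1[c' cc Tc] Sb]|c' /t2[b' /s2[a' aa Sa] Tb]].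
  by exists c' => //; exists b'.
by exists a' => //; exists b'.
Qed.

Lemma same_rank_ltF (V W : woset) (y : W) (x x' : V) :
  same_rank x y -> same_rank x' y -> wo_lt x x' -> False.
Proof.
elim/wo_ind: y x x' => y IH x x' Sxy Sx'y xx'.
have [h _] := same_rank_bisim Sx'y; have [y1 y1y Sxy1] := h _ xx'.
have [_ h2] := same_rank_bisim Sxy; have [x1 x1x Sx1y1] := h2 _ y1y.
exact: IH y1y _ _ Sx1y1 Sxy1 x1x.
Qed.

Lemma same_rank_inj (V W : woset) (y : W) (x x' : V) :
  same_rank x y -> same_rank x' y -> x = x'.
Proof.
move=> Sx Sx'; case: (wo_ltgt x x') => // lt; exfalso.
  exact: same_rank_ltF Sx Sx' lt.
exact: same_rank_ltF Sx' Sx lt.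
Qed.

Lemma same_rank_mono (V W : woset) (x x' : V) (y y' : W) :
  same_rank x y -> same_rank x' y' -> wo_le x x' = wo_le y y'.
Proof.
move=> S S'.
have lt (V' W' : woset) (a a' : V') (b b' : W') :
    same_rank a b -> same_rank a' b' -> wo_lt a' a -> wo_lt b' b.
  move=> Sa Sa' aa; have [h _] := same_rank_bisim Sa.
  have [c cb Sc] := h _ aa.
  by rewrite (same_rank_inj (same_rankC Sa') (same_rankC Sc)).
apply/negb_inj; apply/idP/idP; first exact: lt S S'.
exact: lt (same_rankC S) (same_rankC S').
Qed.

Lemma ot_le_same_rank (V W : woset) :
  ot_le V W <-> forall x : V, exists y : W, same_rank x y.
Proof.
split=> [[f [fm fi]] x|/choice[f fS]].
  exists (f x), (fun a b => b = f a) => // a _ ->; split=> [a' aa|y yfa].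
    by exists (f a') => //; rewrite /wo_lt fm.
  have [a' a'E] := fi _ _ (wo_ltW yfa).
  by exists a' => //; move: yfa; rewrite -a'E /wo_lt fm.
exists f; split=> [x y|x y yfx]; first by rewrite (same_rank_mono (fS x) (fS y)).
have [xy|] := boolP (wo_le (f x) y); first by exists x; exact: wo_le_anti.
have [_ h] := same_rank_bisim (fS x) => /h[x' _ Sx'].
by exists x'; exact: same_rank_inj (same_rankC (fS x')) (same_rankC Sx').
Qed.

Lemma same_rank_total (V W : woset) :
  (forall x : V, exists y : W, same_rank x y) \/
  (forall y : W, exists x : V, same_rank x y).
Proof.
have [|/existsNP[x0 nx0]] := pselect (forall x : V, exists y : W, same_rank x y).
  by left.
right; apply: contrapT => /existsNP[y0 ny0].
have [|x /= nx xmin] := @wo_min V [set x | ~ exists y : W, same_rank x y].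
  by exists x0.
have [|y /= ny ymin] := @wo_min W [set y | ~ exists x : V, same_rank x y].
  by exists y0.
apply: (nx); exists y; exists (fun a b => same_rank a b \/ a = x /\ b = y); last by right.
move=> a b [Sab|[-> ->]].
  have [h1 h2] := same_rank_bisim Sab.
  by split=> [c /h1[d ? ?]|c /h2[d ? ?]]; exists d => //; left.
split=> [a' a'x|b' b'y].
- have [b' Sb'] : exists b' : W, same_rank a' b'.
    by apply: contrapT => /xmin xa'; move: a'x; rewrite /wo_lt xa'.
  exists b'; last by left.
  apply/negP => yb'; apply: (ny).
  have [<-|ne] := pselect (b' = y); first by exists a'.
  have [_ h] := same_rank_bisim Sb'.
  have /h[a'' _ Sa''] : wo_lt y b' by apply/negP => b'y; apply: ne; exact: wo_le_anti.
  by exists a''.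
- have [a' Sa'] : exists a' : V, same_rank a' b'.
    by apply: contrapT => /ymin yb'; move: b'y; rewrite /wo_lt yb'.
  exists a'; last by left.
  apply/negP => xa'; apply: (nx).
  have [<-|ne] := pselect (a' = x); first by exists b'.
  have [h _] := same_rank_bisim Sa'.
  have /h[b'' _ Sb''] : wo_lt x a' by apply/negP => a'x; apply: ne; exact: wo_le_anti.
  by exists b''.
Qed.

Lemma ot_le_min (I : Type) (F : I -> woset) (P : set I) : P !=set0 ->
  exists2 i, P i & forall j, P j -> ot_le (F i) (F j).
Proof.
case=> i0 Pi0; pose D := [set x : F i0 |
  exists2 i, P i & ~ exists v : F i, same_rank v x].
have [D0|D0] := pselect (D !=set0); last first.
  exists i0 => // j Pj; apply/ot_le_same_rank => x; apply: contrapT => nx.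
  apply: D0; exists x; exists j => // -[v Sv].
  by apply: nx; exists v; exact: same_rankC.
have [x /= [i Pi nx] xmin] := wo_min D0.
exists i => // j Pj; apply/ot_le_same_rank => v.
have [y Sy] : exists y : F i0, same_rank v y.
  by have [/(_ v)|/(_ x)/nx] := same_rank_total (F i) (F i0).
have yx : wo_lt y x.
  apply/negP => xy; apply: nx.
  have [<-|ne] := pselect (y = x); first by exists v.
  have [_ h] := same_rank_bisim Sy.
  have /h[u _ Su] : wo_lt x y by apply/negP => yx; apply: ne; exact: wo_le_anti.
  by exists u.
have [u Su] : exists u : F j, same_rank u y.
  apply: contrapT => ny; move/negP: yx; apply; apply: xmin.
  by exists j.
by exists u; exact: same_rank_trans Sy (same_rankC Su).
Qed.

Lemma ot_le_anti (V W : woset) : ot_le V W -> ot_le W V -> ot_eq V W.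
Proof.
move=> /ot_le_same_rank/choice[f fS] /ot_le_same_rank/choice[g gS].
exists f; last by move=> x y; rewrite (same_rank_mono (fS x) (fS y)).
exists g => [x|y].
  exact: same_rank_inj (same_rankC (gS _)) (fS _).
exact: same_rank_inj (same_rankC (fS _)) (gS _).
Qed.

Lemma ot_eq_le (V W : woset) : ot_eq V W -> ot_le V W.
Proof.
by case=> f [g fK gK] fm; exists f; split=> // x y _; exists (g y).
Qed.

Lemma ot_eq_refl (V : woset) : ot_eq V V.
Proof. by exists id => //; exists id. Qed.

Lemma ot_eq_sym (V W : woset) : ot_eq V W -> ot_eq W V.
Proof.
case=> f [g fK gK] fm; exists g; first by exists f.
by move=> x y; rewrite -fm !gK.
Qed.

Lemma ot_le_trans (U V W : woset) : ot_le U V -> ot_le V W -> ot_le U W.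
Proof.
move=> /ot_le_same_rank UV /ot_le_same_rank VW; apply/ot_le_same_rank => x.
have [y Sy] := UV x; have [z Sz] := VW y.
by exists z; exact: same_rank_trans Sy Sz.
Qed.

Lemma ot_eq_trans (U V W : woset) : ot_eq U V -> ot_eq V W -> ot_eq U W.
Proof.
move=> UV VW; apply: ot_le_anti; apply: ot_le_trans.
- exact: ot_eq_le UV.
- exact: ot_eq_le VW.
- exact/ot_eq_le/ot_eq_sym/VW.
- exact/ot_eq_le/ot_eq_sym/UV.
Qed.

Lemma ot_le_sub (W : woset) (A : set W) : ot_le (sub_woset A) W.
Proof.
have [|h] := same_rank_total (sub_woset A) W; first by move/ot_le_same_rank.
have {h} /choice[g gS] := h.
have gm x y : wo_le (val (g x)) (val (g y)) = wo_le x y.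
  by rewrite -(same_rank_mono (gS x) (gS y)).
have ge x : wo_le x (val (g x)).
  elim/wo_ind: x => x IH; have [//|gx] := boolP (wo_le _ _).
  have := IH _ gx; rewrite gm => xgx; move/negP: gx => //.
apply/ot_le_same_rank => x.
have [y yx Sy] : exists2 y, wo_le y (val x) & same_rank x y.
  have [h1 h2] := same_rank_bisim (gS (val x)).
  have xg : wo_le x (g (val x)) by exact: ge.
  have [xE|ne] := pselect (x = g (val x)).
    by exists (val x); [exact: wo_lexx|rewrite {1}xE].
  have /h1[y yx Sy] : wo_lt x (g (val x)).
    by apply/negP => gx; apply: ne; exact: wo_le_anti.
  by exists y => //; exact: wo_ltW.
by exists y.
Qed.

(* The first uncountable ordinal: the isomorphism classes of well-orderings of
   sets of natural numbers, that is, the set of all countable ordinals. *)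

Record nat_wo := NatWo {
  nat_wo_dom : set nat;
  nat_wo_rel : rel nat_wo_dom;
  nat_wo_relP : well_order nat_wo_rel }.

HB.instance Definition _ := gen_eqMixin nat_wo.
HB.instance Definition _ := gen_choiceMixin nat_wo.

Definition nat_woset (r : nat_wo) : woset := WOSet (@nat_wo_relP r).

Definition nat_wo_iso (r s : nat_wo) : bool :=
  `[< ot_eq (nat_woset r) (nat_woset s) >].

Lemma nat_wo_iso_refl : reflexive nat_wo_iso.
Proof. by move=> r; apply/asboolP; exact: ot_eq_refl. Qed.

Lemma nat_wo_iso_sym : symmetric nat_wo_iso.
Proof. by move=> r s; apply/asboolP/asboolP; exact: ot_eq_sym. Qed.

Lemma nat_wo_iso_trans : transitive nat_wo_iso.
Proof.
by move=> s r t /asboolP rs /asboolP st; apply/asboolP; exact: ot_eq_trans st.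
Qed.

Canonical nat_wo_equiv :=
  EquivRel nat_wo_iso nat_wo_iso_refl nat_wo_iso_sym nat_wo_iso_trans.

Definition countable_ordinal := {eq_quot nat_wo_equiv}.

Definition countable_ordinal_le (x y : countable_ordinal) : bool :=
  `[< ot_le (nat_woset (repr x)) (nat_woset (repr y)) >].

Lemma countable_ordinal_le_well_order : well_order countable_ordinal_le.
Proof.
apply: well_order_intro => [x y /asboolP xy /asboolP yx|A A0].
  rewrite -[x]reprK -[y]reprK; apply/eqmodP/asboolP; exact: ot_le_anti.
have [z Az zmin] := ot_le_min (fun x : countable_ordinal => nat_woset (repr x)) A0.
by exists z => // x Ax; apply/asboolP/zmin.
Qed.

Definition omega1 : woset := WOSet countable_ordinal_le_well_order.

Lemma leq_well_order : well_order leq.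
Proof.
apply: well_order_intro => [m n mn nm|A [n An]].
  by apply/eqP; rewrite eqn_leq mn.
have exA : exists n, n \in A by exists n; exact/mem_set.
by case: (ex_minnP exA) => m /set_mem Am mmin; exists m => // k /mem_set/mmin.
Qed.

Definition omega : woset := WOSet leq_well_order.

(* Ordinal exponentiation A ^ B: functions from B to A which take the least
   value of A at all but finitely many places, compared at the largest place
   where they differ. *)

Section Exponentiation.
Variables A B : woset.

Definition exp_supp (f : B -> A) : set B := [set b | exists a, wo_lt a (f b)].

Definition exp_car : set (B -> A) := [set f | finite_set (exp_supp f)].

Definition exp_lt (f g : B -> A) : Prop :=
  exists b, wo_lt (f b) (g b) /\ forall c, wo_lt b c -> f c = g c.

Definition exp_le (f g : exp_car) : bool :=
  `[< f = g \/ exp_lt (val f) (val g) >].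

Lemma exp_suppN (f g : B -> A) b : ~ exp_supp f b -> wo_le (f b) (g b).
Proof. by move=> nf; apply: contrapT => /negP gf; apply: nf; exists (g b). Qed.

Lemma exp_suppNE (f g : B -> A) b :
  ~ exp_supp f b -> ~ exp_supp g b -> f b = g b.
Proof. by move=> nf ng; apply: wo_le_anti; exact: exp_suppN. Qed.

Lemma finite_wo_max (X : set B) : finite_set X -> X !=set0 ->
  exists2 m, X m & forall x, X x -> wo_le x m.
Proof.
move=> /(@finite_seqP {classic B})[s ->] [x /= xs].
elim: s x xs => // y [_ _ _|z s /(_ z (mem_head _ _))[m ms mmax] _ _].
  by exists y => [|x] /=; rewrite mem_seq1 // => /eqP ->; exact: wo_lexx.
have [le|lt] := boolP (@wo_le B y m).
  exists m => [|x] /=; rewrite in_cons; first by rewrite ms orbT.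
  by case/predU1P => [->|/mmax].
exists y => [|x] /=; first exact: mem_head.
rewrite in_cons => /predU1P[->|/mmax xm]; first exact: wo_lexx.
exact: wo_le_trans xm (wo_ltW lt).
Qed.

Definition agree_on (D : set B) (P : set exp_car) :=
  forall f g : exp_car, P f -> P g -> forall b, D b -> val f b = val g b.

Definition has_exp_min (P : set exp_car) :=
  exists2 f, P f & forall g, P g -> exp_le f g.

Lemma exp_min_step (D : set B) (P : set exp_car) :
  (forall b c, D b -> wo_le b c -> D c) ->
  (forall m, ~ D m -> forall Q, Q !=set0 -> agree_on [set c | wo_le m c] Q ->
     has_exp_min Q) ->
  P !=set0 -> agree_on D P -> has_exp_min P.
Proof.
move=> Dup IH P0 PD.
have [[f Pf fD]|noD] := pselect (exists2 f : exp_car, P f & exp_supp (val f) `<=` D).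
  exists f => // g Pg; apply/asboolP.
  have [->|fg] := pselect (f = g); [by left|right].
  pose X := [set b | val f b <> val g b].
  have Xf b : X b -> ~ exp_supp (val f) b.
    by move=> Xb /fD /(PD _ _ Pf Pg).
  have Xg : X `<=` exp_supp (val g).
    move=> b Xb; apply: contrapT => ng; apply: (Xb).
    by apply: exp_suppNE => //; exact: Xf.
  have [||m Xm mmax] := @finite_wo_max X.
  - by apply: sub_finite_set Xg _; exact: set_mem (valP g).
  - apply: contrapT => X0; apply: fg; apply: val_inj; apply/funext => b.
    by apply: contrapT => fgb; apply: X0; exists b.
  exists m; split.
    apply/negP => gf; apply: (Xm); apply: wo_le_anti => //.
    exact: exp_suppN (Xf _ Xm).
  by move=> c mc; apply: contrapT => /mmax cm; rewrite /wo_lt cm in mc.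
pose top (f : exp_car) m := [/\ exp_supp (val f) m, ~ D m &
  forall c, wo_lt m c -> ~ D c -> ~ exp_supp (val f) c].
have topE f : P f -> exists m, top f m.
  move=> Pf; have [||m [fm Dm] mmax] := @finite_wo_max (exp_supp (val f) `&` ~` D).
  - by apply: sub_finite_set (set_mem (valP f)); exact: subIsetl.
  - apply: contrapT => X0; apply: noD; exists f => // b fb.
    by apply: contrapT => Db; apply: X0; exists b.
  by exists m; split=> // c mc Dc fc; move/negP: mc; apply; exact: mmax.
have above f g m c : P f -> P g -> top f m ->
    wo_lt m c -> (~ D c -> ~ exp_supp (val g) c) -> val f c = val g c.
  move=> Pf Pg [_ _ fm] mc gm; have [Dc|Dc] := pselect (D c); first exact: PD.
  by apply: exp_suppNE; [exact: fm|exact: gm].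
have [|m /= [f0 Pf0 f0m] mmin] := @wo_min B [set m | exists2 f, P f & top f m].
  by have [f Pf] := P0; have [m fm] := topE _ Pf; exists m, f.
have [|a /= [f1 [Pf1 f1m f1a]] amin] := @wo_min A
    [set a | exists f : exp_car, [/\ P f, top f m & val f m = a]].
  by exists (val f0 m), f0.
have [|||f /= [Pf fm fa] fmin] := IH m _ [set f | [/\ P f, top f m & val f m = a]].
- by case: f1m.
- by exists f1.
- move=> f g [Pf fm fa] [Pg gm ga] c /= mc.
  have [<-|ne] := pselect (m = c); first by rewrite fa ga.
  have mc' : wo_lt m c by apply/negP => cm; apply: ne; exact: wo_le_anti.
  by case: (gm) => _ _ gt; apply: (above _ _ _ _ Pf Pg fm mc'); exact: gt.
exists f => // g Pg; have [m' gm'] := topE _ Pg.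
have [mE|ne] := pselect (m' = m).
  rewrite {}mE in gm'.
  have [ga|ga] := pselect (val g m = a); first exact: fmin.
  apply/asboolP; right; exists m; split.
    rewrite (_ : val f m = a) //; apply/negP => le; apply: ga; apply: wo_le_anti => //.
    by apply: amin; exists g.
  by move=> c mc; case: (gm') => _ _ gt; apply: (above _ _ _ _ Pf Pg fm mc); exact: gt.
have mm' : wo_lt m m'.
  apply/negP => le; apply: ne; apply: wo_le_anti => //.
  by apply: mmin; exists g.
have [_ _ ftop] := fm; have [[x xg] Dm' gtop] := gm'.
apply/asboolP; right; exists m'; split.
  apply/negP => gf; apply: (ftop _ mm' Dm'); exists x.
  apply/negP => fx; move/negP: xg; apply; exact: wo_le_trans gf fx.
move=> c m'c; apply: (above _ _ _ _ Pf Pg fm (wo_lt_trans mm' m'c)) => Dc.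
exact: gtop.
Qed.

Lemma exp_min (P : set exp_car) : P !=set0 -> has_exp_min P.
Proof.
move=> P0; apply: (@exp_min_step set0) => // m _; elim/wo_ind: m => m IH Q Q0 QD.
apply: (@exp_min_step [set c | wo_le m c]) => // [b c|k /negP mk].
  exact: wo_le_trans.
exact: IH.
Qed.

Lemma exp_le_well_order : well_order exp_le.
Proof.
apply: well_order_intro => [f g /asboolP[//|[b [fgb fg]]] /asboolP[//|[c [gfc gf]]]|].
  case: (wo_ltgt b c) => bc; exfalso.
  - by move: gfc; rewrite fg // wo_ltxx.
  - rewrite -{}bc in gfc; by move: (wo_lt_trans fgb gfc); rewrite wo_ltxx.
  - by move: fgb; rewrite gf // wo_ltxx.
exact: exp_min.
Qed.

Definition exp_woset : woset := WOSet exp_le_well_order.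

End Exponentiation.

Definition omega_pow_omega : woset := exp_woset omega omega.

Definition continuum_hypothesis : Prop := [set: set nat] #= [set: omega1].

Definition nonprincipal_ultrafilter (U : set_system nat) : Prop :=
  UltraFilter U /\ forall n, U <> principal_filter n.

Definition rudin_keisler_le (V U : set_system nat) : Prop :=
  exists f : nat -> nat, V = fmap f U.

Definition ot_bound (a : woset) (U : set_system nat) : Prop :=
  forall h : nat -> omega1, exists2 X, U X & ot_le (sub_woset (h @` X)) a.

(* The least a ranges over all ordinals; it is automatically at most omega1, as
   [alpha_ultrafilter_le_omega1] shows. *)
Definition alpha_ultrafilter (a : woset) (U : set_system nat) : Prop :=
  [/\ nonprincipal_ultrafilter U, ot_bound a U &
      forall b : woset, ot_bound b U -> ot_le a b].

Lemma alpha_ultrafilter_le_omega1 (a : woset) (U : set_system nat) :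
  alpha_ultrafilter a U -> ot_le a omega1.
Proof.
case=> -[UU _] _; apply => h; exists setT; last exact: ot_le_sub.
exact: filterT.
Qed.

(* Main.v *)
(* Call a filter of finite rank if it arises from principal filters by finitely
   many Frechet limits [lim_n F_n = {X : X \in F_n for almost all n}].  The
   ultrafilter is the union of an increasing chain of length omega1 of filters,
   each a countable increasing union of filters [G m] of finite rank.  Under CH the
   chain handles every [h : nat -> omega1] with two kinds of steps.

   - Gluing: a positive set meeting [G k] in a piece with [h]-image of type
     [< omega^omega], chosen so that the pieces escape every bound, has [h]-image of
     type [<= omega^omega].
   - Coarsening: if [h] is constant on no positive set, pick [G k]-positive sets
     [B k] with disjoint [h]-images and replace each [G m] by
     [lim_k (G m restricted to B k)], which again has finite rank.  The map
     [B k |-> k] then factors through [h] and is neither constant nor finite-to-one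
     on the [h]-image of any set in the ultrafilter.

   Hence no ultrafilter below is a P-point, so every non-constant [q_0] starts a
   sequence [q_0, q_1 = p_0 \o q_0, ...] of non-constant maps with infinite fibres,
   and the lexicographic order on [(q_(r-1), ..., q_0)] shows that images of sets in
   the ultrafilter have type [>= omega^r].  As [r] is arbitrary, no bound below
   [omega^omega] is possible. *)
Require Import Defs.
From mathcomp Require Import all_boot all_classical.

Set Implicit Arguments.
Unset Strict Implicit.
Unset Printing Implicit Defensive.

Local Open Scope classical_set_scope.
Local Open Scope card_scope.

(** * Subsets of a well-ordered set of type less than a power of omega *)

(* [small r A]: the order type of [A] is less than [omega ^ r]. *)
Inductive small (W : woset) : nat -> set W -> Prop :=
| small_set0 r : small r set0
| smallU r A B : small r A -> small r B -> small r (A `|` B)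
| small_sub r A B : A `<=` B -> small r B -> small r A
| small_segments r A :
    (forall x, A x -> small r (A `&` [set y | wo_lt y x])) -> small r.+1 A.

Lemma small0E (W : woset) (A : set W) : small 0 A -> A = set0.
Proof.
move: {-2}0 (erefl 0) => r rE sA; elim: sA rE => // {}r {}A B.
  by move=> _ IHA _ IHB r0; rewrite IHA // IHB // setU0.
by move=> AB _ IH /IH B0; rewrite -subset0 -B0.
Qed.

Lemma small_leS (W : woset) r (A : set W) : small r A -> small r.+1 A.
Proof.
elim=> [s|s B C _ ? _ ?|s B C BC _ ?|s B _ IH].
- exact: small_set0.
- exact: smallU.
- exact: small_sub BC _.
- exact: small_segments.
Qed.

Lemma small_le (W : woset) r s (A : set W) : r <= s -> small r A -> small s A.
Proof.
by move=> /subnKC <-; elim: (s - r) => [|n IH] sA; rewrite ?addn0 // addnS;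
  exact/small_leS/IH.
Qed.

Lemma small1 (W : woset) (x : W) : small 1 [set x].
Proof.
apply: small_segments => y ->; apply: small_sub (small_set0 _ _).
by move=> z [/= ->]; rewrite wo_ltxx.
Qed.

Lemma small_bigcup (W : woset) r (A : nat -> set W) N :
  (forall n, n < N -> small r (A n)) -> small r (\bigcup_(n in `I_N) A n).
Proof.
elim: N => [_|N IH sA].
  by rewrite II0 bigcup_set0; exact: small_set0.
apply: (@small_sub _ _ _ ((\bigcup_(n in `I_N) A n) `|` A N)).
  move=> x [n /= ]; rewrite ltnS leq_eqVlt => /predU1P[-> ?|nN ?]; first by right.
  by left; exists n.
by apply: smallU; [apply: IH => n nN; apply: sA; exact: ltnW|exact: sA].
Qed.

(** Induction on [small]: [R] carries initial segments of [Z] into initial segments of [S]. A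
    relation replaces a map so that [same_rank] can be used directly. *)
Lemma small_transfer (V W : woset) (R : V -> W -> Prop) r (S : set W) (Z : set V) :
  (forall z z' s s', R z s -> R z' s' -> wo_lt z z' -> wo_lt s s') ->
  small r S -> (forall z, Z z -> exists2 s, S s & R z s) -> small r Z.
Proof.
move=> Rm sS; elim: sS Z => {r S} [r|r A B _ IHA _ IHB|r A B AB _ IH|r A _ IH] Z ZS.
- by apply: small_sub (small_set0 _ _) => z /ZS[].
- apply: (@small_sub _ _ _ ([set z | exists2 s, A s & R z s] `|`
                            [set z | exists2 s, B s & R z s])).
    by move=> z /ZS[s [As|Bs] Rzs]; [left|right]; exists s.
  by apply: smallU; [exact: IHA|exact: IHB].
- by apply: IH => z /ZS[s /AB ? ?]; exists s.
- apply: small_segments => z /ZS[s As Rzs]; apply: (IH s As) => z' [/ZS[s' As' Rzs'] zz].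
  by exists s' => //; split=> //; exact: Rm Rzs' Rzs zz.
Qed.

(** * Positive sets and gluing *)

Definition ev (P : nat -> Prop) := exists N, forall n, N <= n -> P n.
Definition io (P : nat -> Prop) := forall N, exists2 n, N <= n & P n.

Lemma evI P Q : ev P -> ev Q -> ev (fun n => P n /\ Q n).
Proof.
move=> [M PM] [N QN]; exists (maxn M N) => n; rewrite geq_max => /andP[Mn Nn].
by split; [exact: PM|exact: QN].
Qed.

Lemma ev_sub (P Q : nat -> Prop) : (forall n, P n -> Q n) -> ev P -> ev Q.
Proof. by move=> PQ [N PN]; exists N => n /PN/PQ. Qed.

Lemma io_sub (P Q : nat -> Prop) : (forall n, P n -> Q n) -> io P -> io Q.
Proof. by move=> PQ Pio N; have [n Nn /PQ] := Pio N; exists n. Qed.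

Lemma ioN P : ~ io P -> ev (fun n => ~ P n).
Proof.
by move=> /existsNP[N nP]; exists N => n Nn Pn; apply: nP; exists n.
Qed.

Lemma evN P : ~ ev P -> io (fun n => ~ P n).
Proof.
move=> nP N; apply: contrapT => h; apply: nP; exists N => n Nn.
by apply: contrapT => nPn; apply: h; exists n.
Qed.

Lemma io_ev (P Q : nat -> Prop) : io P -> ev Q -> io (fun n => P n /\ Q n).
Proof.
move=> Pio [M QM] N; have [n] := Pio (maxn M N).
by rewrite geq_max => /andP[Mn Nn] Pn; exists n => //; split=> //; exact: QM.
Qed.

Lemma ioU (P Q : nat -> Prop) : io (fun n => P n \/ Q n) -> io P \/ io Q.
Proof.
move=> PQ; apply: contrapT => /not_orP[/ioN nP /ioN nQ].
by have [n _ [[Pn|Qn] []]] := io_ev PQ (evI nP nQ) 0.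
Qed.

Definition pos T (F : set_system T) (A : set T) := ~ F (~` A).

Section Positive.
Variables (T : Type) (F : set_system T).
Context {FF : Filter F}.

Lemma pos_sub A B : A `<=` B -> pos F A -> pos F B.
Proof. by move=> AB pA FB; apply: pA; apply: filterS FB; exact: subsetC. Qed.

Lemma posI A B : pos F A -> F B -> pos F (A `&` B).
Proof.
move=> pA FB FAB; apply: pA; apply: filterS (filterI FAB FB).
by move=> x [nAB Bx] Ax; apply: nAB.
Qed.

Lemma posU A B : pos F (A `|` B) -> pos F A \/ pos F B.
Proof.
move=> pAB; apply: contrapT => /not_orP[/contrapT FA /contrapT FB].
by apply: pAB; rewrite setCU; exact: filterI.
Qed.

End Positive.

Lemma pos_filter T (F : set_system T) {FF : ProperFilter F} A : F A -> pos F A.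
Proof.
move=> FA FnA; apply: (filter_not_empty F).
by apply: filterS (filterI FA FnA) => x [].
Qed.

Lemma filter_forall_lt T (F : set_system T) {FF : Filter F} (A : nat -> set T) N :
  (forall n, n < N -> F (A n)) -> F [set x | forall n, n < N -> A n x].
Proof.
elim: N => [_|N IH FA]; first exact: filterS filterT.
apply: filterS (filterI (IH _) (FA N _)) => //.
  by move=> x [lt eq] n; rewrite ltnS leq_eqVlt => /predU1P[->|/lt].
by move=> n nN; apply: FA; exact: ltnW.
Qed.

Section Glue.
Variables (W : woset) (h : nat -> W) (F : nat -> set_system nat).
Context {FF : forall n, Filter (F n)}.
Variable good : set W -> Prop.
Hypothesis good0 : good set0.
Hypothesis goodU : forall A B, good A -> good B -> good (A `|` B).
Hypothesis good_sub : forall A B, A `<=` B -> good B -> good A.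
Hypothesis good_dense : forall n B, pos (F n) B ->
  exists A, [/\ A `<=` B, pos (F n) A & good (h @` A)].

Let good_bigcup (A : nat -> set nat) N : (forall n, good (h @` A n)) ->
  good (h @` (\bigcup_(n in `I_N) A n)).
Proof.
move=> gA; elim: N => [|N IH]; first by rewrite II0 bigcup_set0 image_set0.
apply: good_sub (goodU IH (gA N)) => _ [x [n /= + Ax] <-].
rewrite ltnS leq_eqVlt => /predU1P[nN|nN]; last by left; exists x => //; exists n.
by right; exists x => //; rewrite -nN.
Qed.

(** Pieces are chosen one by one, the [k]-th above the values of all points of [S] numbered below
    [k]. Below the value of a point [x] only pieces numbered at most [x] appear, a finite union. The
    ideal [good] stays abstract to serve both a fixed power of omega and everything below
    [omega^omega]. *)
Lemma glue_unbounded (S : set nat) : io (fun n => pos (F n) S) ->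
  (forall i, S i -> ev (fun n => ~ pos (F n) (S `&` [set j | wo_le (h j) (h i)]))) ->
  exists A, [/\ A `<=` S, io (fun n => pos (F n) A) &
    forall x, (h @` A) x -> good (h @` A `&` [set y | wo_lt y x])].
Proof.
move=> Sio Sev.
pose above k := S `&` [set j | forall i, i < k -> S i -> wo_lt (h i) (h j)].
have step k : exists p : nat * set nat, [/\ k <= p.1, p.2 `<=` above k,
    pos (F p.1) p.2 & good (h @` p.2)].
  have evk : ev (fun n => forall i, i < k -> S i ->
      F n (~` (S `&` [set j | wo_le (h j) (h i)]))).
    elim: k {above} => [|k IH]; first by exists 0.
    have [Sk|nSk] := pselect (S k).
      apply: ev_sub (evI IH (Sev k Sk)) => n [lt eq] i.
      rewrite ltnS leq_eqVlt => /predU1P[-> _|/lt//]; exact: contrapT.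
    apply: ev_sub IH => n lt i; rewrite ltnS leq_eqVlt => /predU1P[->//|/lt//].
  have [n kn [pS lt]] := io_ev Sio evk k.
  have /good_dense[A [Aab pA gA]] : pos (F n) (above k).
    apply: pos_sub (posI pS (@filter_forall_lt _ (F n) _
      (fun i => [set j | S i -> ~ (S `&` [set j | wo_le (h j) (h i)]) j]) k _)).
      move=> j [Sj ltj]; split=> // i ik Si; apply/negP => le.
      exact: (ltj _ ik Si).
    move=> i ik; have [Si|nSi] := pselect (S i).
      by apply: filterS (lt i ik Si) => j nj _.
    by apply: filterS filterT => j _ /nSi.
  by exists (n, A).
have /choice[p pP] := step; pose A k := (p k).2.
exists (\bigcup_k A k); split.
- by move=> x [k _]; have [_ sub _ _] := pP k => /sub[].
- move=> N; have [Nn _ pA _] := pP N; exists (p N).1 => //.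
  by apply: pos_sub pA => x Ax; exists N.
- move=> _ [x [k _ Akx] <-].
  have Sx : S x by have [_ sub _ _] := pP k; case: (sub _ Akx).
  have := @good_bigcup A x.+1 (fun n => let: And4 _ _ _ g := pP n in g).
  apply: good_sub => _ [[y [m _ Amy] <-] /= yx]; exists y => //; exists m => //=.
  rewrite ltnNge; apply/negP => xm; have [_ sub _ _] := pP m.
  have [_ /(_ x xm Sx) xy] := sub _ Amy.
  by move: (wo_lt_trans xy yx); rewrite wo_ltxx.
Qed.

(* Either positivity is already carried by one fibre of [h], or, below the least
   bound making [B] positive infinitely often, it escapes every smaller bound. *)
Lemma glue_positive (B : set nat) : io (fun n => pos (F n) B) ->
  exists A, [/\ A `<=` B, io (fun n => pos (F n) A) &
    forall x, (h @` A) x -> good (h @` A `&` [set y | wo_lt y x])].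
Proof.
move=> Bio; pose le v := B `&` [set j | wo_le (h j) v].
have [|noi] := pselect ([set v | io (fun n => pos (F n) (le v))] !=set0); last first.
  apply: glue_unbounded => // i Bi; apply: ioN => io_i.
  by apply: noi; exists (h i).
case/wo_min=> v /= vio vmin.
have : io (fun n => pos (F n) (le v `&` [set j | wo_lt (h j) v]) \/
                    pos (F n) (B `&` [set j | h j = v])).
  apply: io_sub vio => n pv; apply: posU; apply: pos_sub pv => j [Bj jv].
  have [eq|ne] := pselect (h j = v); first by right.
  by left; split=> //; apply/negP => vj; apply: ne; exact: wo_le_anti.
case/ioU => [Sio|Eio].
  have [i [[Bi _] iv]|A [AS Aio Ag]] := glue_unbounded Sio.
    apply: ioN => iio; move/negP: iv; apply; apply: vmin.
    by apply: io_sub iio => n; apply: pos_sub => j [[[Bj _] _] ji].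
  by exists A; split=> // x /AS[[]].
exists (B `&` [set j | h j = v]); split=> // x [i [_ iv] <-].
apply: good_sub good0 => _ [[j [_ jv] <-]].
by rewrite /= iv jv wo_ltxx.
Qed.

End Glue.

(** * Filters of finite rank *)

Fixpoint finite_rank T r (F : set_system T) : Prop :=
  if r is r'.+1 then
    exists2 G : nat -> set_system T, forall n, finite_rank r' (G n) &
      forall X, F X <-> ev (fun n => G n X)
  else exists x, forall X, F X <-> X x.

Lemma finite_rank_proper T r (F : set_system T) : finite_rank r F -> ProperFilter F.
Proof.
elim: r F => [|r IH] F /=.
  case=> x Fx; split=> [/Fx//|]; split=> [|A B /Fx ? /Fx ?|A B AB /Fx ?]; apply/Fx => //.
  exact: AB.
case=> G /(_ _)/IH Gp FG; split=> [/FG[n /(_ _ (leqnn n))]|].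
  exact: (filter_not_empty (G n)).
split=> [|A B /FG FA /FG FB|A B AB /FG FA]; apply/FG.
- by exists 0 => n _; exact: filterT.
- by apply: ev_sub (evI FA FB) => n []; exact: filterI.
- by apply: ev_sub FA => n; exact: filterS.
Qed.

Lemma finite_rank_fmap T U (f : T -> U) r (F : set_system T) :
  finite_rank r F -> finite_rank r (fmap f F).
Proof.
elim: r F => [|r IH] F /=.
  by case=> x Fx; exists (f x) => X; exact: Fx.
by case=> G Gr FG; exists (fun n => fmap f (G n)) => [n|X]; [exact: IH|exact: FG].
Qed.

Lemma finite_rank_within T r (F : set_system T) B :
  finite_rank r F -> pos F B -> finite_rank r (within B F).
Proof.
elim: r F => [|r IH] F /=.
  case=> x Fx pB; have Bx : B x by apply: contrapT => nBx; apply: pB; exact/Fx.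
  by exists x => X; split=> [/Fx/(_ Bx)//|Xx]; exact/Fx.
case=> G Gr FG pB.
have Gp n := finite_rank_proper (Gr n).
have Bio : io (fun n => pos (G n) B) by apply: evN => evB; exact/pB/FG.
(* [s n] is [n] when [B] is [G n]-positive and a later positive index otherwise. At the skipped
   indices [within B (G n)] contains every set, so the limit does not change. *)
have /choice[s sP] n : exists m, [/\ n <= m, pos (G m) B & pos (G n) B -> m = n].
  have [pn|np] := pselect (pos (G n) B); first by exists n.
  by have [m nm pm] := Bio n; exists m.
exists (fun n => within B (G (s n))) => [n|X].
  by have [_ p _] := sP n; exact: IH.
have wE : within B F X <-> ev (fun n => within B (G n) X) by exact: FG.
apply: (iff_trans wE); split=> [[N BN]|].
  by exists N => n Nn; have [ns _ _] := sP n; apply: BN; exact: leq_trans ns.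
apply: ev_sub => n; have [_ _ sE] := sP n.
have [/sE ->//|/contrapT GnB _] := pselect (pos (G n) B).
by rewrite /within; apply: (@filterS _ (G n)) GnB => x nBx Bx; case: (nBx Bx).
Qed.

(** A principal filter is handled by a singleton; each Frechet limit costs one power of omega, since
    gluing makes all proper segments of the image [small r.+1]. *)
Lemma finite_rank_small_dense (W : woset) (h : nat -> W) r (F : set_system nat) B :
  finite_rank r F -> pos F B ->
  exists A, [/\ A `<=` B, pos F A & small r.+1 (h @` A)].
Proof.
elim: r F B => [|r IH] F B /=.
  case=> x Fx pB; have Bx : B x by apply: contrapT => nBx; apply: pB; exact/Fx.
  exists [set x]; split; [by move=> _ ->|by move/Fx; apply|].
  by rewrite image_set1; exact: small1.
case=> G Gr FG pB; have Gp n := finite_rank_proper (Gr n).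
have Bio : io (fun n => pos (G n) B) by apply: evN => evB; exact/pB/FG.
have [||||A [AB Aio Ag]] := @glue_positive W h G _ (@small W r.+1) _ _ _ _ B Bio.
- exact: small_set0.
- exact: smallU.
- exact: small_sub.
- by move=> n C; exact: IH.
exists A; split=> //; last exact: small_segments.
by move=> /FG evA; have [n _ []] := io_ev Aio evA 0.
Qed.

(** Greedy recursion: [C k], the union of the sets already chosen, stays in [N]. In the applications
    [N] consists of the sets outside an ultrafilter. *)
Lemma disjoint_seq T (N : set (set T)) (P : nat -> set T -> Prop) :
  N set0 -> (forall A B, N A -> N B -> N (A `|` B)) ->
  (forall C k, N C -> exists Z, [/\ N Z, Z `<=` ~` C & P k Z]) ->
  exists Z : nat -> set T, (forall k, P k (Z k)) /\
    (forall j k x, Z j x -> Z k x -> j = k).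
Proof.
move=> N0 NU NP.
have /choice[f fP] (p : nat * set T) :
    exists Z, N p.2 -> [/\ N Z, Z `<=` ~` p.2 & P p.1 Z].
  have [/(NP _ p.1)[Z ZP]|nN] := pselect (N p.2); first by exists Z.
  by exists set0.
pose C := fix C k := if k is k'.+1 then C k' `|` f (k', C k') else set0.
have NC k : N (C k).
  by elim: k => [//|k IH]; apply: NU => //; have [] := fP (k, C k) IH.
pose Z k := f (k, C k).
have ZC j k x : j < k -> Z j x -> C k x.
  elim: k => // k IH; rewrite ltnS leq_eqVlt => /predU1P[-> Zx|jk Zx].
    by right.
  by left; exact: IH.
have Zlt j k x : j < k -> Z j x -> ~ Z k x.
  by move=> jk /(ZC _ _ _ jk) Cx; have [_ ZnC _] := fP (k, C k) (NC k) => /ZnC.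
exists Z; split=> [k|j k x Zj Zk]; first by have [] := fP (k, C k) (NC k).
by case: (ltngtP j k) => // lt; exfalso; [exact: Zlt lt Zj Zk|exact: Zlt lt Zk Zj].
Qed.

(* The ultrafilter case would make the approximating filters converge to an
   ultrafilter along infinitely many disjoint positive sets, which is impossible. *)
Lemma finite_rank_split T r (F : set_system T) :
  finite_rank r F -> (forall v, F (~` [set v])) ->
  exists Y, pos F Y /\ pos F (~` Y).
Proof.
elim: r F => [|r IH] F Fr Fv.
  by case: Fr => x Fx; case: (iffLR (Fx _) (Fv x)).
have Fp := finite_rank_proper Fr; case: Fr => G Gr FG.
have Gp n := finite_rank_proper (Gr n).
apply: contrapT => nosplit.
have Fult Y : F Y \/ F (~` Y).
  apply: contrapT => /not_orP[nY nYc]; apply: nosplit; exists (~` Y).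
  by split; rewrite /pos setCK.
have FnC C : ~ F C -> F (~` C) by case: (Fult C).
have [||C k nC|Z [Zpos Zdis]] := @disjoint_seq T [set C | ~ F C]
  (fun k Z => exists2 n, k <= n & pos (G n) Z).
- exact: (filter_not_empty F).
- move=> A B /= /FnC FA /FnC FB FAB; apply: (filter_not_empty F).
  by apply: filterS (filterI FAB (filterI FA FB)) => x [[Ax|Bx] []].
- have /FG[N GN] := FnC _ nC; pose n := maxn k N.
  have GnC : G n (~` C) by apply: GN; exact: leq_maxr.
  (* If [G n] is free, the induction hypothesis splits it and a half outside [F] is kept; otherwise
     a [G n]-positive singleton serves, as [F] is free. *)
  have [/IH|] := pselect (forall v, G n (~` [set v])).
    case/(_ (Gr n)) => Y [pY pYc].
    have [FY|nFY] := pselect (F Y); last first.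
      exists (Y `&` ~` C); split; [|exact: subIsetr|].
        by move=> FYC; apply: nFY; apply: filterS FYC => x [].
      by exists n; [exact: leq_maxl|exact: posI].
    exists (~` Y `&` ~` C); split; [|exact: subIsetr|].
      move=> FYC; apply: (filter_not_empty F).
      by apply: filterS (filterI FY FYC) => x [? []].
    by exists n; [exact: leq_maxl|exact: posI].
  case/existsNP=> v pv; exists ([set v] `&` ~` C); split; [|exact: subIsetr|].
    move=> FvC; apply: (filter_not_empty F).
    by apply: filterS (filterI (Fv v) FvC) => x [? []].
  by exists n; [exact: leq_maxl|exact: posI].
pose Y := \bigcup_(k in [set k | odd k]) Z k.
(* A set in [F] lies in [G n] for all large [n], so it cannot miss infinitely many [Z k]; but [Y]
   misses the even ones and its complement the odd ones. The index [N.*2 + b] is at least [N] and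
   has parity [b]. *)
have nF b (A : set T) : (forall k, odd k = b -> Z k `<=` ~` A) -> ~ F A.
  move=> ZA /FG[N GN]; pose k := N.*2 + b.
  have [n kn pn] := Zpos k; apply: pn.
  have /GN : N <= n by apply: leq_trans kn; rewrite /k -addnn -addnA leq_addr.
  apply: filterS => x Ax Zkx; apply: (ZA k _ x Zkx Ax).
  by rewrite /k oddD odd_double oddb.
have [] := Fult Y; [apply: (nF false)|apply: (nF true)] => k kb x Zkx.
  by case=> j /= jb Zjx; move: jb; rewrite (Zdis _ _ _ Zjx Zkx) kb.
by apply; exists k.
Qed.

Lemma filter_preimage_finite T U (F : set_system T) {FF : Filter F} (h : T -> U)
    (E : set U) :
  (forall v, F [set x | h x <> v]) -> finite_set E -> F [set x | ~ E (h x)].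
Proof.
move=> Fv /(@finite_seqP {classic U})[s ->].
elim: s => [|v s IH]; first by apply: filterS filterT.
apply: filterS (filterI (Fv v) IH) => x [nv ns] /=.
by rewrite in_cons => /predU1P[/nv|/ns].
Qed.

(** * Approximations to the ultrafilter *)

Definition approximation (G : nat -> set_system nat) :=
  [/\ forall n, exists r, finite_rank r (G n),
      forall n, G n `<=` G n.+1 & forall i, G 0 (~` [set i])].

Definition limit_filter (G : nat -> set_system nat) : set_system nat :=
  \bigcup_n G n.

(** Inclusion is required term by term, not just between unions, so that the terms of many
    approximations can be interleaved into one increasing sequence. *)
Definition extends (H G : nat -> set_system nat) :=
  forall m, exists n, G m `<=` H n.

Lemma extends_refl G : extends G G.
Proof. by move=> m; exists m. Qed.

Lemma extends_trans G H K : extends G H -> extends H K -> extends G K.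
Proof.
move=> GH HK m; have [n Kn] := HK m; have [k Hk] := GH n.
by exists k; exact: subset_trans Hk.
Qed.

Lemma extends_limit G H : extends H G -> limit_filter G `<=` limit_filter H.
Proof. by move=> HG X [m _ Gm]; have [n sub] := HG m; exists n => //; exact: sub. Qed.

Section Approximation.
Variable G : nat -> set_system nat.
Hypothesis aG : approximation G.

Lemma approximation_le m n : m <= n -> G m `<=` G n.
Proof.
have [_ GS _] := aG.
move=> /subnKC <-; elim: (n - m) => [|k IH]; first by rewrite addn0.
by rewrite addnS; exact: subset_trans IH (GS _).
Qed.

Lemma approximation_proper n : ProperFilter (G n).
Proof. by have [Gr _ _] := aG; have [r] := Gr n; exact: finite_rank_proper. Qed.

Lemma pos_limit A : pos (limit_filter G) A <-> forall n, pos (G n) A.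
Proof.
split=> [pA n GA|pA [n _]]; [apply: pA; exists n => //|exact: pA].
Qed.

Lemma limit_filter_proper : ProperFilter (limit_filter G).
Proof.
have Gp := approximation_proper.
split=> [[n _]|]; first exact: (filter_not_empty (G n)).
split=> [|A B [m _ GA] [n _ GB]|A B AB [n _ GA]].
- by exists 0 => //; exact: filterT.
- exists (maxn m n) => //; have := Gp (maxn m n) => Gmn; apply: filterI.
    exact: approximation_le (leq_maxl _ _) _ GA.
  exact: approximation_le (leq_maxr _ _) _ GB.
- by exists n => //; exact: filterS GA.
Qed.

Lemma restrict_approximation A : pos (limit_filter G) A ->
  exists H, [/\ approximation H, extends H G & limit_filter H A].
Proof.
move/pos_limit=> pA; have Gp := approximation_proper; have [Gr GS G0] := aG.
have sub n : G n `<=` within A (G n).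
  by move=> X GX; apply: (@filterS _ (G n)) GX => x Xx _.
exists (fun n => within A (G n)); split=> [|m|].
- split=> [n|n X|i].
  + by have [r Gnr] := Gr n; exists r; exact: finite_rank_within.
  + exact: GS.
  + exact: sub.
- by exists m.
- by exists 0 => //; apply: (@filterS _ (G 0)) filterT.
Qed.

Lemma sum_approximation (B : nat -> set nat) : (forall k, pos (G k) (B k)) ->
  exists H, [/\ approximation H, extends H G &
    forall m X, ev (fun k => G m [set x | B k x -> X x]) -> H m X].
Proof.
move=> pB; have Gp := approximation_proper; have [Gr GS G0] := aG.
have sub m : G m `<=` [set X | ev (fun k => G m [set x | B k x -> X x])].
  by move=> X GX; exists 0 => k _; apply: filterS GX => x Xx _.
exists (fun m => [set X | ev (fun k => G m [set x | B k x -> X x])]).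
split=> // [|m]; last by exists m.
split=> [m|m X|i].
- have [r Gmr] := Gr m; exists r.+1.
  (* [B k] is known to be [G m]-positive only for [k >= m], hence the shift by [m]. *)
  exists (fun k => within (B (m + k)) (G m)) => [k|X].
    apply: finite_rank_within => // GB; apply: (pB (m + k)).
    exact: approximation_le (leq_addr _ _) _ GB.
  split=> -[N GN].
    by exists N => k Nk; apply: GN; exact: leq_trans Nk (leq_addl _ _).
  exists (m + N) => k mNk; have mk := leq_trans (leq_addr _ _) mNk.
  by rewrite -(subnKC mk); apply: GN; rewrite leq_subRL.
- by apply: ev_sub => k; exact: GS.
- exact: sub.
Qed.

(** The ranks of the [G n] may be unbounded, so gluing uses the ideal of all sets of type below
    [omega^omega]. *)
Lemma approximation_glue (W : woset) (h : nat -> W) :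
  exists H, [/\ approximation H, extends H G & exists2 A, limit_filter H A &
    forall x, (h @` A) x -> exists r, small r (h @` A `&` [set y | wo_lt y x])].
Proof.
have Gp := approximation_proper; have [Gr _ _] := aG.
have [|||||A [_ Aio Ag]] :=
  @glue_positive W h G _ (fun A => exists r, small r A) _ _ _ _ setT.
- by exists 0; exact: small_set0.
- move=> A B [r sA] [s sB]; exists (maxn r s).
  by apply: smallU; [exact: small_le (leq_maxl _ _) sA|exact: small_le (leq_maxr _ _) sB].
- by move=> A B AB [r sB]; exists r; exact: small_sub sB.
- move=> n B pB; have [r Gnr] := Gr n.
  have [A [AB pA sA]] := finite_rank_small_dense h Gnr pB.
  by exists A; split=> //; exists r.+1.
- by move=> n; exists n => //; apply: pos_filter; exact: filterT.
have [|H [aH HG HA]] := @restrict_approximation A.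
  apply/pos_limit => n GA; have [k nk pA] := Aio n.
  by apply: pA; exact: approximation_le nk _ GA.
by exists H; split=> //; exists A.
Qed.

End Approximation.

(* In the second case, [p] witnesses that the image of an ultrafilter extending [F]
   under [h] is not a P-point. *)
Definition decides T (h : nat -> T) (F : set_system nat) :=
  (exists v, F [set x | h x = v]) \/
  exists p : T -> nat, (forall n, F [set x | p (h x) <> n]) /\
    forall X, pos F X -> exists n, ~ finite_set (h @` (X `&` [set x | p (h x) = n])).

Lemma decides_sub T (h : nat -> T) (F F' : set_system nat) :
  F `<=` F' -> decides h F -> decides h F'.
Proof.
move=> FF' [[v /FF' Fv]|[p [pn pX]]]; first by left; exists v.
right; exists p; split=> [n|X pF']; first exact: FF'.
by apply: pX => /FF'.
Qed.

Lemma approximation_coarsen T (h : nat -> T) G m :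
  approximation G -> (forall v, G m [set x | h x <> v]) ->
  exists H, [/\ approximation H, extends H G & decides h (limit_filter H)].
Proof.
move=> aG Gv; have Gp := approximation_proper aG; have [Gr _ _] := aG.
have Jp := limit_filter_proper aG.
(* [U] guides the choice of the [Z k]: the sets outside it are closed under finite unions, and of
   two complementary halves given by [finite_rank_split] one lies outside it. *)
have [U [UU JU]] : exists U, UltraFilter U /\ fmap h (limit_filter G) `<=` U.
  exact: ultraFilterLemma.
have UnC C : ~ U C -> U (~` C) by have [] := in_ultra_setVsetC C UU.
have [||C k nC|Z [Zpos Zdis]] := @disjoint_seq T [set C | ~ U C]
  (fun k Z => exists2 n, k <= n & pos (G n) (h @^-1` Z)).
- exact: (filter_not_empty U).
- move=> A B /= /UnC FA /UnC FB FAB; apply: (filter_not_empty U).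
  by apply: filterS (filterI FAB (filterI FA FB)) => x [[Ax|Bx] []].
- pose n := maxn k m; have [r Gnr] := Gr n.
  have pC : pos (fmap h (G n)) (~` C).
    move=> GC; apply: nC; apply: JU; exists n => //.
    by move: GC; rewrite setCK.
  have Fr := finite_rank_within (finite_rank_fmap h Gnr) pC.
  have [v|Y [pY pYc]] := finite_rank_split Fr.
    apply: (@filterS _ (G n)) (approximation_le aG (leq_maxr k m) (Gv v)) => x nv _.
    exact: nv.
  have pYC Y' : pos (within (~` C) (fmap h (G n))) Y' ->
      pos (G n) (h @^-1` (Y' `&` ~` C)).
    move=> p GY; apply: p; apply: (@filterS _ (G n)) GY => x nY Cx Yx.
    exact: nY.
  have [UY|nUY] := pselect (U Y).
    exists (~` Y `&` ~` C); split; [|exact: subIsetr|].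
      move=> UYC; apply: (filter_not_empty U).
      by apply: filterS (filterI UY UYC) => x [? []].
    by exists n; [exact: leq_maxl|exact: pYC].
  exists (Y `&` ~` C); split; [|exact: subIsetr|].
    by move=> UYC; apply: nUY; apply: filterS UYC => x [].
  by exists n; [exact: leq_maxl|exact: pYC].
have pZ k : pos (G k) (h @^-1` Z k).
  by have [n kn p] := Zpos k => GZ; apply: p; exact: approximation_le kn _ GZ.
have [H [aH HG HS]] := sum_approximation aG pZ.
exists H; split=> //; right.
(* [p] names the piece containing [v]; the default 0 is taken off all pieces, which is a null set
   for [H]. *)
have /choice[p pP] v : exists n, forall k, Z k v -> n = k.
  have [[k Zk]|nZ] := pselect (exists k, Z k v); last first.
    by exists 0 => k Zk; case: nZ; exists k.
  by exists k => j; exact: Zdis.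
exists p; split=> [n|X pX].
  exists 0 => //; apply: HS; exists n.+1 => k nk.
  by apply: filterS filterT => x _ /pP pk kn; rewrite -kn pk ltnn in nk.
(* If all these images were finite, then, the fibres of [h] being [G m]-null, [X] would be
   [G m]-null on every piece and hence [H m]-null. *)
apply: contrapT => /forallNP fin; apply: pX; exists m => //; apply: HS; exists 0 => k _.
have /contrapT finE := fin k.
apply: filterS (filter_preimage_finite Gv finE) => x nE Zx Xx.
by apply: nE; exists x => //; split=> //; exact: pP.
Qed.

(** A fibre positive for the limit is added to the filter; if all fibres are null for one [G m],
    coarsening applies. Otherwise each [G m] has a positive fibre, and summing over these first
    makes every fibre null in term 0. *)
Lemma approximation_decide T (h : nat -> T) G : approximation G ->
  exists H, [/\ approximation H, extends H G & decides h (limit_filter H)].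
Proof.
move=> aG; have Gp := approximation_proper aG.
have [[v pv]|nv] := pselect (exists v, pos (limit_filter G) [set x | h x = v]).
  have [H [aH HG Hv]] := restrict_approximation aG pv.
  by exists H; split=> //; left; exists v.
have [[m Gm]|noev] := pselect (exists m, forall v, G m [set x | h x <> v]).
  exact: approximation_coarsen Gm.
have /choice[v pv] m : exists v, pos (G m) [set x | h x = v].
  have /existsNP[v nGv] : ~ forall v, G m [set x | h x <> v].
    by move=> Gm; apply: noev; exists m.
  by exists v.
have [H [aH HG HS]] := sum_approximation aG pv.
have [w|K [aK KH Kd]] := @approximation_coarsen _ h H 0 aH.
  have /existsNP[n /contrapT Gn] : ~ forall n, pos (G n) [set x | h x = w].
    by move/(pos_limit G) => pw; apply: nv; exists w.
  apply: HS; exists n => k nk; apply: filterS filterT => x _ hx hw.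
  apply: (pv k); rewrite -hx hw; exact: approximation_le nk _ Gn.
by exists K; split=> //; exact: extends_trans KH HG.
Qed.

(** * Chains of approximations and the continuum hypothesis *)

Lemma directed_seq T (le : T -> T -> Prop) (X : set T) (e : nat -> T) :
  (forall a b, X a -> X b -> exists c, [/\ X c, le a c & le b c]) ->
  (forall k, X (e k)) ->
  exists g : nat -> T,
    [/\ forall k, X (g k), forall k, le (g k) (g k.+1) & forall k, le (e k) (g k.+1)].
Proof.
move=> Xdir Xe.
have /choice[j jP] (p : T * T) :
    exists c, X p.1 -> X p.2 -> [/\ X c, le p.1 c & le p.2 c].
  have [[X1 X2]|nX] := pselect (X p.1 /\ X p.2).
    by have [c cP] := Xdir _ _ X1 X2; exists c.
  by exists p.1 => ? ?; case: nX.
pose g := fix g k := if k is k'.+1 then j (g k', e k') else e 0.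
have Xg k : X (g k) by elim: k => //= k IH; have [] := jP (g k, e k) IH (Xe k).
by exists g; split=> // k; have [] := jP (g k, e k) (Xg k) (Xe k).
Qed.

Lemma cofinite_approximation : approximation (fun=> [set X | ev X]).
Proof.
split=> [_|_ X //|i].
  by exists 1; exists (fun n => [set X | X n]) => // n; exists n.
by exists i.+1 => n + nE; rewrite nE ltnn.
Qed.

(** Upper bounds at stages below [omega1]: [s] makes the chain countable, and the new sequence
    consists of terms [f b m] themselves, so finite rank is kept. *)
Lemma approximation_chain (I : Type) (P : set I) (s : I -> nat)
    (f : I -> nat -> set_system nat) :
  (forall b c, P b -> P c -> s b = s c -> b = c) ->
  (forall b, P b -> approximation (f b)) ->
  (forall b c, P b -> P c -> extends (f b) (f c) \/ extends (f c) (f b)) ->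
  exists H, approximation H /\ forall b, P b -> extends H (f b).
Proof.
move=> s_inj af f_chain.
have [[b0 Pb0]|P0] := pselect (P !=set0); last first.
  exists (fun=> [set X | ev X]); split; first exact: cofinite_approximation.
  by move=> b Pb; case: P0; exists b.
(* [t] inverts [s], with default value [b0] off its range. *)
have /choice[t tP] n : exists b, P b /\ forall c, P c -> s c = n -> c = b.
  have [[b Pb sb]|nb] := pselect (exists2 b, P b & s b = n).
    by exists b; split=> // c Pc sc; apply: s_inj; rewrite ?sc.
  by exists b0; split=> // c Pc sc; case: nb; exists c.
pose e k := if unpickle k is Some (n, m) then f (t n) m else f b0 0.
pose X := [set F | exists b, P b /\ exists m, F = f b m].
have [||g [Xg gS eg]] := @directed_seq _ (@subset (set nat)) X e.
- move=> _ _ [b [Pb [m ->]]] [c [Pc [n ->]]].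
  wlog bc : b c m n Pb Pc / extends (f c) (f b).
    move=> wl; have [bc|cb] := f_chain _ _ Pb Pc; last exact: wl.
    by have [d [? ? ?]] := wl c b n m Pc Pb bc; exists d.
  have [k bk] := bc m; exists (f c (maxn k n)); split.
  + by exists c; split=> //; exists (maxn k n).
  + by apply: (subset_trans bk); apply: (approximation_le (af c Pc)); exact: leq_maxl.
  + by apply: (approximation_le (af c Pc)); exact: leq_maxr.
- move=> k; rewrite /e; case: (unpickle k) => [[n m]|]; last first.
    by exists b0; split=> //; exists 0.
  by exists (t n); split; [have [] := tP n|exists m].
exists g; split; last first.
  move=> b Pb m; exists (pickle (s b, m)).+1.
  apply: subset_trans (eg _); rewrite /e pickleK.
  by have [_ /(_ b Pb erefl) <-] := tP (s b).
split=> [n|//|i].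
  by have [b [/af[fr _ _] [m ->]]] := Xg n; exact: fr.
have [b [Pb [m ->]]] := Xg 0; apply: (approximation_le (af b Pb) (leq0n m)).
by have [_ _] := af b Pb.
Qed.

Lemma transfinite_choice (W : woset) (P : Type) (p0 : P) (ext : P -> P -> Prop)
    (D : W -> P -> Prop) :
  (forall a f, (forall b, wo_lt b a -> D b (f b)) ->
    (forall b c, wo_lt c b -> wo_lt b a -> ext (f b) (f c)) ->
    exists p, D a p /\ forall b, wo_lt b a -> ext p (f b)) ->
  exists f : W -> P, forall a, D a (f a) /\ forall b, wo_lt b a -> ext (f a) (f b).
Proof.
move=> step.
have /choice[S SP] (q : W * (W -> P)) : exists p,
    (forall b, wo_lt b q.1 -> D b (q.2 b)) ->
    (forall b c, wo_lt c b -> wo_lt b q.1 -> ext (q.2 b) (q.2 c)) ->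
    D q.1 p /\ forall b, wo_lt b q.1 -> ext p (q.2 b).
  have [[h1 h2]|nh] := pselect ((forall b, wo_lt b q.1 -> D b (q.2 b)) /\
    (forall b c, wo_lt c b -> wo_lt b q.1 -> ext (q.2 b) (q.2 c))).
    by have [p pP] := step q.1 q.2 h1 h2; exists p.
  by exists p0 => h1 h2; case: nh.
have wf : well_founded (fun x y : W => wo_lt x y).
  by move=> x; elim/wo_ind: x => x IH; constructor.
(* Recursion supplies values only below [a]; padding with [p0] gives the total map that [S]
   expects. *)
pose restr (a : W) (rec : forall b, wo_lt b a -> P) b :=
  if Sumbool.sumbool_of_bool (wo_lt b a) is left ba then rec b ba else p0.
pose f := Fix wf (fun=> P) (fun a rec => S (a, restr a rec)).
have fE a : f a = S (a, restr a (fun b _ => f b)).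
  rewrite /f Fix_eq // => x r1 r2 r12; congr (S (x, _)); apply/funext => b.
  by rewrite /restr; case: Sumbool.sumbool_of_bool.
have rE a b : wo_lt b a -> restr a (fun b _ => f b) b = f b.
  by move=> ba; rewrite /restr; case: Sumbool.sumbool_of_bool => //; rewrite ba.
exists f; elim/wo_ind => a IH; rewrite [f a]fE.
have [||Dp extp] := SP (a, restr a (fun b _ => f b)).
- by move=> b /= ba; rewrite rE //; have [] := IH b ba.
- move=> b c /= cb ba; rewrite !rE //; last exact: wo_lt_trans cb ba.
  by have [_] := IH b ba; apply.
by split=> // b ba; have := extp b ba; rewrite /= rE.
Qed.

(** A representative of [a] lives on a set of naturals, and [s b] is its element of rank [b]: the
    least one without a partner in [R b]. *)
Lemma omega1_segment (a : omega1) : exists s : omega1 -> nat,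
  forall b c, wo_lt b a -> wo_lt c a -> s b = s c -> b = c.
Proof.
pose R (b : omega1) := nat_woset (repr b).
have lt_v b : wo_lt b a -> exists v : R a,
    (forall u : R b, ~ same_rank v u) /\
    (forall w, wo_lt w v -> exists u : R b, same_rank w u).
  move=> /negP nab.
  have nv : [set v : R a | ~ exists u : R b, same_rank v u] !=set0.
    apply/existsNP => vu; apply: nab; apply/asboolP/ot_le_same_rank => v.
    exact: contrapT (vu v).
  have [v /= nvu vmin] := wo_min nv; exists v; split=> [u vu|w wv].
    by apply: nvu; exists u.
  by apply: contrapT => /vmin vw; case/negP: wv.
have /choice[s sP] (b : omega1) : exists n : nat, wo_lt b a -> exists v : R a,
    [/\ val v = n, forall u : R b, ~ same_rank v u &
     forall w, wo_lt w v -> exists u : R b, same_rank w u].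
  have [/lt_v[v [v1 v2]]|nba] := pselect (wo_lt b a).
    by exists (val v) => _; exists v.
  by exists 0.
exists s => b c ba ca sbc.
have le b' c' : wo_lt b' a -> wo_lt c' a -> s b' = s c' -> ot_le (R b') (R c').
  move=> /[dup] b'a /sP[v [vn v1 v2]] /sP[w [wn w1 w2]] E.
  have vw : v = w by apply: val_inj; rewrite vn wn.
  rewrite -{w wn}vw in w1 w2; apply/ot_le_same_rank => u.
  have [v' v'u] : exists v' : R a, same_rank u v'.
    have [/(_ u)//|] := same_rank_total (R b') (R a).
    by move=> /(_ v)[x /same_rankC /v1].
  have [|x vx] := w2 v'; last by exists x; exact: same_rank_trans vx.
  apply/negP => vv'; have [_ h] := same_rank_bisim v'u.
  have [vE|ne] := pselect (v = v').
    by apply: (v1 u); apply: same_rankC; rewrite vE.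
  have /h[x _ /same_rankC /v1//] : wo_lt v v'.
  by apply/negP => v'v; apply: ne; exact: wo_le_anti.
by apply: wo_le_anti; apply/asboolP; exact: le.
Qed.

Section Continuum.
Hypothesis CH : continuum_hypothesis.

Lemma omega1_subsets : exists2 A : omega1 -> set nat,
  injective A & forall S, exists a, A a = S.
Proof.
have /card_set_bijP[A [_ Ainj Asurj]] : [set: omega1] #= [set: set nat].
  exact: card_esym.
exists A => [a b AE|S]; first by apply: Ainj AE; exact: in_setT.
by have [a _ <-] := Asurj S I; exists a.
Qed.

(** Cantor's diagonal argument, applied to the enumeration of all subsets of [nat] by [omega1]. *)
Lemma omega1_uncountable (s : omega1 -> nat) : ~ injective s.
Proof.
have [A _ Asurj] := omega1_subsets => s_inj.
pose T := [set n | exists2 a, s a = n & ~ A a n].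
have [a aT] := Asurj T.
have [Tsa|nT] := pselect (T (s a)); last first.
  by apply: (nT); exists a => //; rewrite aT.
by case: (Tsa) => b /s_inj ->; rewrite aT.
Qed.

Lemma nat_omega1_inj : exists i : nat -> omega1, injective i.
Proof.
have [A _ Asurj] := omega1_subsets.
have /choice[i iP] (n : nat) := Asurj [set n].
exists i => m n imn; have : A (i m) m by rewrite iP.
by rewrite imn iP.
Qed.

(** A map into [omega1] amounts to a sequence of subsets of [nat], hence to one subset of the plane,
    coded by pairing. *)
Lemma omega1_functions : exists e : omega1 -> nat -> omega1, forall h, exists a, e a = h.
Proof.
have [A Ainj Asurj] := omega1_subsets; have /choice[B BK] := Asurj.
exists (fun a n => B [set m | A a (pickle (n, m))]) => h.
have [a aE] := Asurj [set k | exists n m, k = pickle (n, m) /\ A (h n) m].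
exists a; apply/funext => n; apply: Ainj; rewrite BK aE.
apply/seteqP; split=> [m [n' [m' [/(pcan_inj pickleK)[-> ->]]]] //|m Am].
by exists n, m.
Qed.

(** The range of [g] is countable, so [omega1] cannot embed in it. This turns maps into
    [omega^omega] into maps that [ot_bound] tests. *)
Lemma omega1_represents (V : woset) (g : nat -> V) : exists h : nat -> omega1,
  forall x y, wo_le (h x) (h y) = wo_le (g x) (g y).
Proof.
have gP x : g x \in range g by apply/mem_set; exists x.
pose g' x : sub_woset (range g) := exist _ (g x) (gP x).
have [/choice[k kP]|/choice[k kP]] := same_rank_total (sub_woset (range g)) omega1.
  exists (k \o g') => x y.
  exact: esym (same_rank_mono (kP (g' x)) (kP (g' y))).
have /choice[s sP] (v : sub_woset (range g)) : exists n, g n = val v.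
  by have /set_mem[n _ gn] := valP v; exists n.
case: (@omega1_uncountable (s \o k)) => a b /= sab.
have kab : k a = k b by apply: val_inj; rewrite -!sP sab.
apply: same_rank_inj (same_rankC (kP a)) _.
by rewrite kab; exact: same_rankC.
Qed.

End Continuum.

(** * Small subsets of omega ^ omega *)

(** The ordinal [omega * f + y]: [y] is the new least significant digit. *)
Definition exp_cons_fun (y : nat) (f : nat -> nat) (b : nat) : nat :=
  if b is b'.+1 then f b' else y.

Lemma exp_cons_subproof y (f : omega_pow_omega) :
  exp_cons_fun y (val f) \in @exp_car omega omega.
Proof.
apply/mem_set; apply: (@sub_finite_set _ _
  ([set 0] `|` S @` (exp_supp (val f : omega -> omega)))).
  move=> [|b] fb; [by left|right; exists b => //].
rewrite finite_setU; split; first exact: finite_set1.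
exact/finite_image/(set_mem (valP f)).
Qed.

Definition exp_cons y (f : omega_pow_omega) : omega_pow_omega :=
  exist (fun g => g \in @exp_car omega omega) _ (exp_cons_subproof y f).

Lemma exp_zero_subproof : (fun=> 0) \in @exp_car omega omega.
Proof.
apply/mem_set; apply: (@sub_finite_set _ _ set0); last exact: finite_set0.
by move=> b [a].
Qed.

Definition exp_zero : omega_pow_omega :=
  exist (fun g => g \in @exp_car omega omega) _ exp_zero_subproof.

Lemma wo_lt_omega (m n : omega) : wo_lt m n = (m < n).
Proof. by rewrite ltnNge. Qed.

Lemma exp_ltP (f g : omega_pow_omega) :
  wo_lt f g <-> exp_lt (val f : omega -> omega) (val g).
Proof.
split=> [fg|[b [fgb fgE]]].
  case/asboolP: (wo_ltW fg) => [fE|//]; by rewrite fE wo_ltxx in fg.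
apply/negP => /asboolP[gf|[c [gfc gfE]]]; first by rewrite gf wo_ltxx in fgb.
case: (wo_ltgt b c) => bc.
- by rewrite fgE // wo_ltxx in gfc.
- by rewrite -bc in gfc; move: (wo_lt_trans fgb gfc); rewrite wo_ltxx.
- by rewrite gfE // wo_ltxx in fgb.
Qed.

Lemma exp_cons_lt y z (f g : omega_pow_omega) :
  wo_lt f g -> wo_lt (exp_cons y f) (exp_cons z g).
Proof.
move=> /exp_ltP[b [fgb fgE]]; apply/exp_ltP; exists b.+1; split=> // -[|c].
  by rewrite wo_lt_omega.
by rewrite wo_lt_omega => bc; apply: fgE; rewrite wo_lt_omega.
Qed.

Lemma exp_cons_ltl y z (f : omega_pow_omega) :
  y < z -> wo_lt (exp_cons y f) (exp_cons z f).
Proof.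
move=> yz; apply/exp_ltP; exists 0; split; first by rewrite wo_lt_omega.
by case.
Qed.

(** Division by omega: for fixed [f] the points [exp_cons y f] form a block of type omega, and the
    block of a smaller [g] lies wholly below it, so segments of points yield segments of blocks. *)
Lemma small_exp_cons r (Z : set omega_pow_omega) :
  small r.+1 Z -> small r [set f | io (fun y => Z (exp_cons y f))].
Proof.
move: {-1}r.+1 (erefl r.+1) => s + sZ; elim: sZ r => {s Z}.
- by move=> s r _; apply: small_sub (small_set0 _ _) => f /(_ 0)[].
- move=> s A B _ IHA _ IHB r sr; apply: small_sub (smallU (IHA r sr) (IHB r sr)).
  by move=> f /ioU.
- move=> s A B AB _ IH r sr; apply: small_sub (IH r sr) => f.
  by apply: io_sub => y /AB.
move=> s A sA IH r [->] {r}; case: s sA IH => [|s] sA IH.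
  (* Segments in [small 0] are empty, so [A] has at most one point and meets no block twice. *)
  apply: small_sub (small_set0 _ _) => f Af.
  have [y _ Ay] := Af 0; have [z yz Az] := Af y.+1.
  have : (A `&` [set g | wo_lt g (exp_cons z f)]) (exp_cons y f).
    by split=> //; exact: exp_cons_ltl.
  by rewrite (small0E (sA _ Az)).
apply: small_segments => f Af; have [y _ Ay] := Af 0.
apply: small_sub (IH _ Ay s erefl) => g [Ag gf].
by apply: io_sub Ag => z Az; split=> //; exact: exp_cons_lt.
Qed.

Lemma omega_pow_omega_not_small r : ~ small r [set: omega_pow_omega].
Proof.
elim: r => [/small0E T0|r IH /small_exp_cons sT].
  by have : [set: omega_pow_omega] exp_zero by []; rewrite T0.
by apply: IH; apply: small_sub sT => f _ N; exists N.
Qed.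

(** The cylinder has type [omega^n]. In the induction step, points below [x] have digit [n] at most
    that of [x], so finitely many cylinders with one more digit fixed cover the segment. *)
Lemma omega_pow_omega_cylinder_small n (f : nat -> nat) :
  small n.+1 [set g : omega_pow_omega | forall c, n <= c -> val g c = f c].
Proof.
elim: n f => [|n IH] f; apply: small_segments => x xf.
  apply: small_sub (small_set0 _ _) => y [yf /=].
  suff -> : y = x by rewrite wo_ltxx.
  by apply/val_inj/funext => c; rewrite yf // xf.
apply: small_sub (@small_bigcup _ _ (fun m => [set g : omega_pow_omega |
  forall c, n <= c -> val g c = if c == n then m else f c]) (val x n).+1 _) => //.
move=> y [yf /exp_ltP[b [yxb yxE]]]; exists (val y n) => /=.
  rewrite ltnS; move: yxb; rewrite wo_lt_omega.
  case: (ltngtP b n) => [bn _|nb|-> /ltnW//].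
    by rewrite yxE // wo_lt_omega.
  by rewrite yf // xf // ltnn.
by move=> c; rewrite leq_eqVlt eq_sym => /predU1P[->|nc]; rewrite ?eqxx // gtn_eqF // yf.
Qed.

Lemma omega_pow_omega_segment_small (f : omega_pow_omega) :
  exists r, small r [set g | wo_lt g f].
Proof.
have [n fn] : exists n, forall c, n <= c -> val f c = 0.
  have f0 c : ~ exp_supp (val f : omega -> omega) c -> val f c = 0.
    move=> nf; apply/eqP; rewrite -leqn0 leqNgt; apply/negP => fc; apply: nf.
    by exists 0; rewrite wo_lt_omega.
  have [fs0|nfs] := pselect (exp_supp (val f : omega -> omega) !=set0); last first.
    by exists 0 => c _; apply: f0 => fc; apply: nfs; exists c.
  have [m _ mmax] := finite_wo_max (set_mem (valP f)) fs0.
  exists m.+1 => c mc; apply: f0 => /mmax cm.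
  by move: mc; rewrite ltnNge => /negP; apply.
exists n.+1; apply: small_sub (omega_pow_omega_cylinder_small n (fun=> 0)).
move=> g /exp_ltP[b [gfb gfE]] c nc; rewrite -[RHS](fn c nc).
case: (leqP n b) => nb; first by move: gfb; rewrite fn // wo_lt_omega.
by apply: gfE; rewrite wo_lt_omega; exact: leq_trans nc.
Qed.

Lemma same_rank_below (V W : woset) (x v : V) (w : W) :
  ~ (exists w' : W, same_rank x w') -> same_rank v w -> wo_lt v x.
Proof.
move=> nx vw; apply/negP => xv; apply: nx.
have [->|ne] := pselect (x = v); first by exists w.
have [h _] := same_rank_bisim vw.
have /h[w' _ ?] : wo_lt x v by apply/negP => vx; apply: ne; exact: wo_le_anti.
by exists w'.
Qed.

Lemma same_rank_lt (V W : woset) (x x' : V) (y y' : W) :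
  same_rank x y -> same_rank x' y' -> wo_lt x x' -> wo_lt y y'.
Proof. by move=> xy xy'; rewrite /wo_lt (same_rank_mono xy' xy). Qed.

(** Otherwise all of [omega^omega] would embed into a proper segment of [Y] and so be [small r]. *)
Lemma ot_le_omega_pow_omega (W : woset) (Y : set W) :
  (forall x, Y x -> exists r, small r (Y `&` [set y | wo_lt y x])) ->
  ot_le (sub_woset Y) omega_pow_omega.
Proof.
move=> Ysmall; apply/ot_le_same_rank => x; apply: contrapT => nx.
have [/(_ x)//|rk] := same_rank_total (sub_woset Y) omega_pow_omega.
have [r sr] := Ysmall _ (set_mem (valP x)).
apply: (@omega_pow_omega_not_small r).
apply: (small_transfer
  (R := fun f s => exists2 y : sub_woset Y, val y = s & same_rank y f) _ sr) => [f g _ _ [y <- yf] [z <- zg] fg|f _].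
  exact: same_rank_lt (same_rankC yf) (same_rankC zg) fg.
have [y yf] := rk f; exists (val y); last by exists y.
by split; [exact: set_mem (valP y)|exact: same_rank_below nx yf].
Qed.

(** Such a [b] embeds below some element [f], whose segment bounds the rank uniformly in [Y]. *)
Lemma lt_omega_pow_omega_small (b : woset) : ~ ot_le omega_pow_omega b ->
  exists r, forall (V : woset) (Y : set V), ot_le (sub_woset Y) b -> small r Y.
Proof.
move=> nb.
have /existsNP[f nf] : ~ forall f : omega_pow_omega, exists y : b, same_rank f y.
  by move/ot_le_same_rank.
have [/(_ f)//|rk] := same_rank_total omega_pow_omega b.
have [r sr] := omega_pow_omega_segment_small f; exists r => V Y /ot_le_same_rank Yb.
apply: (small_transfer
  (R := fun v g => exists2 y : sub_woset Y, val y = v & same_rank y g) _ sr) => [_ _ g g' [y <- yg] [z <- zg']|v Yv].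
  exact: (@same_rank_lt _ _ y z).
have [w yw] := Yb (exist _ v (mem_set Yv)); have [g gw] := rk w.
exists g; first exact: same_rank_below nf gw.
by exists (exist _ v (mem_set Yv)) => //; exact: same_rank_trans yw (same_rankC gw).
Qed.

(** * The generic ultrafilter *)

Section Large_images.
Variables (U : set_system nat) (i : nat -> omega1).
Context {UU : UltraFilter U}.
Hypothesis i_inj : injective i.
Hypothesis Udec : forall h : nat -> omega1, decides h U.

(** [p] comes from [decides] for [i \o q]. If the points of [X] whose [p]-fibre meets the image of
    [X] only finitely often formed a set in [U], all its fibres would have finite image, against
    [decides]. *)
Lemma ultra_not_P_point (q : nat -> nat) : (forall n, U [set x | q x <> n]) ->
  exists p : nat -> nat, (forall n, U [set x | p (q x) <> n]) /\
    forall X, U X -> U [set x | X x /\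
      io (fun y => p y = p (q x) /\ exists2 x', X x' & q x' = y)].
Proof.
move=> qU; have [[v Uv]|[p [pU pX]]] := Udec (i \o q).
  have [x xv] := filter_ex Uv; have [x' [x'v]] := filter_ex (filterI Uv (qU (q x))).
  by case; apply: i_inj; rewrite [LHS]x'v [RHS]xv.
exists (p \o i); split=> // X UX; set X1 := (X in U X).
have [//|UnX1] := in_ultra_setVsetC X1 UU.
have [n] := pX (X `&` ~` X1) (pos_filter (filterI UX UnX1)); case.
have [[x [[Xx nX1x] xn]]|n0] := pselect (exists x, (X `&` ~` X1) x /\ p (i (q x)) = n);
  last first.
  by apply: sub_finite_set (finite_set0 _) => v [x [? ?] _]; case: n0; exists x.
have /ioN[N xN] : ~ io (fun y => p (i y) = p (i (q x)) /\ exists2 x', X x' & q x' = y).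
  by move=> xio; apply: nX1x.
apply: sub_finite_set (finite_image i (finite_II N)) => _ [x' [[Xx' _] x'n] <-] /=.
exists (q x') => //=; rewrite ltnNge; apply/negP => /xN; apply; split.
  by rewrite xn.
by exists x'.
Qed.

(** [g] writes the values of [q], [p \o q] and so on as digits, lowest first. Almost every point of
    [X] lies in a block met infinitely often, so [small_exp_cons] strips the digit [q] and induction
    applies to [p \o q]. *)
Lemma ultra_image_not_small r (q : nat -> nat) : (forall n, U [set x | q x <> n]) ->
  exists g : nat -> omega_pow_omega, forall X, U X -> ~ small r ((g \o q) @` X).
Proof.
elim: r q => [|r IH] q qU.
  exists (fun=> exp_zero) => X UX /small0E X0; have [x Xx] := filter_ex UX.
  by suff : (set0 : set omega_pow_omega) exp_zero by []; rewrite -X0; exists x.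
have [p [pU pX]] := ultra_not_P_point qU; have [g gU] := IH (p \o q) pU.
exists (fun y => exp_cons y (g (p y))) => X UX /small_exp_cons.
apply: contra_not (gU _ (pX X UX)) => sX; apply: small_sub sX.
move=> _ [x [Xx xio] <-]; apply: io_sub xio => y [py [x' Xx' x'y]].
by exists x' => //=; rewrite x'y py.
Qed.

End Large_images.

(** Stage [a] settles the map [e a]; every map is some [e a], and what a stage settles persists in
    the union. *)
Lemma generic_ultrafilter : continuum_hypothesis -> exists U : set_system nat,
  [/\ UltraFilter U, forall n, U (~` [set n]),
      forall h : nat -> omega1, decides h U & ot_bound omega_pow_omega U].
Proof.
move=> CH; have [e eP] := omega1_functions CH; have [i i_inj] := nat_omega1_inj CH.
have [|f fP] := @transfinite_choice omega1 _ (fun=> [set X | ev X]) extends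
  (fun a H => [/\ approximation H, decides (e a) (limit_filter H) &
    exists2 A, limit_filter H A & forall x, (e a @` A) x ->
      exists r, small r (e a @` A `&` [set y | wo_lt y x])]).
  move=> a f fD f_chain; have [s s_inj] := omega1_segment a.
  have [|||G [aG Gf]] := @approximation_chain omega1 [set b | wo_lt b a] s f.
  - by move=> b c; exact: s_inj.
  - by move=> b /fD[].
  - move=> b c ba ca; case: (wo_ltgt b c) => bc.
    + by right; exact: f_chain.
    + by left; rewrite bc; exact: extends_refl.
    + by left; exact: f_chain.
  have [H [aH HG Hd]] := approximation_decide (e a) aG.
  have [K [aK KH KA]] := approximation_glue aH (e a).
  exists K; split; first by split=> //; exact: decides_sub (extends_limit KH) Hd.
  by move=> b /Gf; apply: extends_trans; exact: extends_trans KH HG.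
pose U : set_system nat := \bigcup_a limit_filter (f a).
have fU a : limit_filter (f a) `<=` U by move=> X; exists a.
have fp a : ProperFilter (limit_filter (f a)).
  by have [[aH _ _] _] := fP a; exact: limit_filter_proper.
have mono a b : wo_le b a -> limit_filter (f b) `<=` limit_filter (f a).
  move=> ba; have [->//|ne] := pselect (b = a).
  have [_ ext] := fP a; apply: extends_limit; apply: ext.
  by apply/negP => ab; apply: ne; exact: wo_le_anti.
have Up : ProperFilter U.
  split=> [[a _]|]; first exact: (filter_not_empty (limit_filter (f a))).
  split=> [|A B [a _ aA] [b _ bB]|A B AB [a _ aA]].
  - by exact: (fU (i 0) _ filterT).
  - have [ab|ba] := orP (wo_le_total a b).
      by apply: (fU b); apply: filterI => //; exact: mono ab _ aA.
    by apply: (fU a); apply: filterI => //; exact: mono ba _ bB.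
  - by apply: (fU a); exact: filterS aA.
have Ud (h : nat -> omega1) : decides h U.
  have [a <-] := eP h; have [[_ d _] _] := fP a; exact: decides_sub d.
(* A two-valued map is decided only by being constant on a set in [U]. *)
have UVC A : U A \/ U (~` A).
  have [[v Uv]|[p [_ pX]]] := Ud (fun x => i `[< A x >]).
    have [x xv] := filter_ex Uv.
    have Ax y : i `[< A y >] = v -> (A y <-> A x).
      by move=> yv; have /i_inj := etrans yv (esym xv); do 2!case: asboolP.
    have [Axx|nAx] := pselect (A x); [left|right]; apply: filterS Uv => y /Ax.
      by case=> _; apply.
    by move=> yx /yx.
  have [n] := pX setT (pos_filter filterT); case.
  apply: sub_finite_set (finite_image i (finite_II 2)) => _ [x _ <-].
  by exists (nat_of_bool `[< A x >]) => //=; case: `[< _ >].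
exists U; split=> //.
- split=> // G Gp UG; apply/seteqP; split=> // A GA.
  have [//|/UG GnA] := UVC A; exfalso; apply: (filter_not_empty G).
  by apply: filterS (filterI GA GnA) => x [].
- move=> n; pose a := i 0; apply: (fU a); exists 0 => //.
  by have [[[_ _ ]]] := fP a.
- move=> h; have [a <-] := eP h; have [[_ _ [A aA As]] _] := fP a.
  by exists A; [exact: fU aA|exact: ot_le_omega_pow_omega].
Qed.

Theorem theorem3p4 (CH : continuum_hypothesis) :
  exists U : set_system nat,
    alpha_ultrafilter omega_pow_omega U /\
    forall W : set_system nat,
      nonprincipal_ultrafilter W -> rudin_keisler_le W U ->
      alpha_ultrafilter omega_pow_omega W.
Proof.
have [U [UU U1 Ud Ub]] := generic_ultrafilter CH.
have [i i_inj] := nat_omega1_inj CH.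
have below W : nonprincipal_ultrafilter W -> rudin_keisler_le W U ->
    alpha_ultrafilter omega_pow_omega W.
  move=> Wnp [f WE]; split=> // [h|b bW].
    have [X UX Xo] := Ub (h \o f); exists (f @` X).
      by rewrite WE; apply: (@filterS _ U) UX => x Xx; exists x.
    by rewrite image_comp.
  apply: contrapT => /lt_omega_pow_omega_small[r bs].
  (* [f] is constant on no set of [U], since otherwise [W] would be principal. *)
  have fU n : U [set x | f x <> n].
    have [Wu nW] := Wnp.
    have [Un|//] := in_ultra_setVsetC [set x | f x = n] UU; case: (nW n).
    have Wn : W [set n] by rewrite WE.
    apply/seteqP; split=> X; last first.
      by move/principal_filterP => Xn; apply: filterS Wn => _ ->.
    move=> WX; apply/principal_filterP.
    by have [x [Xx <-]] := filter_ex (filterI WX Wn).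
  have [g gU] := ultra_image_not_small i_inj Ud r fU.
  have [h hg] := omega1_represents CH g; have [X WX /bs sX] := bW h.
  rewrite WE in WX; apply: (gU _ WX).
  apply: (small_transfer (R := fun v s => exists2 y, g y = v & h y = s) _ sX).
    by move=> _ _ _ _ [y <- <-] [z <- <-]; rewrite /wo_lt hg.
  by move=> _ [x Xx <-]; exists (h (f x)); [exists (f x)|exists (f x)].
(* [U] itself is the case of the identity map. *)
exists U; split=> //; apply: below; last by exists id.
split=> // n UE; apply: (filter_not_empty U).
have Un : U [set n] by rewrite UE; exact/principal_filterP.
by apply: filterS (filterI Un (U1 n)) => x [].
Qed.
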